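(* Let $n\ge3$, and let $h\in\mathcal M_n$ be the increasing root vector of $\mathrm{He}_n$. There are $\delta_n,B_n>0$ such that, for every $r\in\mathcal M_n$ with $e_0=\|r-h\|_2<\delta_n$, $$\|T_n^k(r)-h\|_2\le\exp(B_ne_0)\,2^{-k/2}e_0\qquad(k\ge0).$$ Thus the prefactor tends to one as the initial root vector tends to $h$.
   Context: Finite free additive convolution: for $p(x)=\sum_{k=0}^n(-1)^ka_kx^{n-k}$ and $q(x)=\sum_{k=0}^n(-1)^kb_kx^{n-k}$ with $a_0=b_0=1$, set $(p\boxplus_n q)(x)=\sum_{k=0}^n(-1)^kc_kx^{n-k}$ with $c_k=\sum_{i+j=k}\frac{(n-i)!(n-j)!}{n!(n-k)!}a_ib_j$; it preserves real-rootedness, and simple inputs give simple outputs. For $c>0$ and monic $f$ of degree $n$, $c_*f(x)=c^nf(x/c)$ (dilation of the roots by $c$). $P_r(x)=\prod_{i=1}^n(x-r_i)$. $\mathcal M_n=\{r\in\mathbb R^n:\ r_1<\cdots<r_n,\ \sum_ir_i=0,\ \|r\|_2^2=n(n-1)\}$. The map $T_n:\mathcal M_n\to\mathcal M_n$ sends $r$ to the increasingly ordered root vector of $2^{-1/2}_*(P_r\boxplus_nP_r)$; $T_n^k$ is its $k$-th iterate. $\mathrm{He}_n$ is the monic probabilists' Hermite polynomial, $\mathrm{He}_n''-x\mathrm{He}_n'+n\mathrm{He}_n=0$; its root vector $h$ lies in $\mathcal M_n$ and satisfies $T_n(h)=h$. *)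

(* Defs.v *)
From HB Require Import structures.
From mathcomp Require Import all_boot all_order all_algebra.
From mathcomp Require Import all_classical all_reals all_analysis.
Set Implicit Arguments.
Unset Strict Implicit.
Unset Printing Implicit Defensive.
Import Order.TTheory GRing.Theory Num.Theory.
Import numFieldNormedType.Exports.
Local Open Scope classical_set_scope.
Local Open Scope ring_scope.

Definition norm2 (R : realType) (n : nat) (r : 'rV[R]_n) : R :=
  Num.sqrt (\sum_(i < n) r 0 i ^+ 2).

Definition polyr (R : realType) (n : nat) (r : 'rV[R]_n) : {poly R} :=
  \prod_(i < n) ('X - (r 0 i)%:P).

(* The a_k of p = \sum_(k <= n) (-1)^k a_k X^(n-k). *)
Definition acoef (R : realType) (n : nat) (p : {poly R}) (k : nat) : R :=
  (-1) ^+ k * p`_(n - k).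

(* All uses have i, j <= k <= n, so no natural-number subtraction truncates. *)
Definition boxplus_coef (R : realType) (n : nat) (p q : {poly R}) (k : nat) : R :=
  \sum_(i < n.+1) \sum_(j < n.+1 | (i + j == k)%N)
    (((n - i)`! * (n - j)`!)%:R / (n`! * (n - k)`!)%:R)
      * acoef n p i * acoef n q j.

Definition boxplus (R : realType) (n : nat) (p q : {poly R}) : {poly R} :=
  \sum_(k < n.+1) ((-1) ^+ k * boxplus_coef n p q k) *: 'X^(n - k).

Definition dilation (R : realType) (n : nat) (c : R) (f : {poly R}) : {poly R} :=
  c ^+ n *: (f \Po (c^-1 *: 'X)).

Definition increasing (R : realType) (n : nat) (r : 'rV[R]_n) : Prop :=
  forall i j : 'I_n, (i < j)%N -> r 0 i < r 0 j.

Definition increasing_root_vector (R : realType) (n : nat) (p : {poly R})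
    (r : 'rV[R]_n) : Prop :=
  increasing r /\ polyr r = p.

Definition Mn (R : realType) (n : nat) : set 'rV[R]_n :=
  [set r | [/\ increasing r, \sum_(i < n) r 0 i = 0
             & norm2 r ^+ 2 = n%:R * (n%:R - 1)]].
Arguments Mn : clear implicits.

(* An increasing root vector is unique when it exists. The default value 0 is
   taken only when 2^(-1/2)_*(P_r [+]_n P_r) is not simply real-rooted, which
   does not happen for r in M_n; for n >= 2 the vector 0 is outside M_n. *)
Definition Tn (R : realType) (n : nat) (r : 'rV[R]_n) : 'rV[R]_n :=
  xget 0 [set s | increasing_root_vector
                    (dilation n (2 `^ (- 2^-1)) (boxplus n (polyr r) (polyr r)))
                    s].

(* Monic probabilists' Hermite polynomials; [hermite_monic], [size_hermite] and
   [hermite_ode] give the characterization by He'' - x He' + n He = 0. *)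
Fixpoint hermite (R : realType) (n : nat) : {poly R} :=
  if n is m.+1 then 'X * hermite R m - (hermite R m)^`() else 1.

Lemma size_hermite_monic (R : realType) (n : nat) :
  size (hermite R n) = n.+1 /\ hermite R n \is monic.
Proof.
elim: n => [|n [sn mn]] /=; first by rewrite size_poly1 monic1.
have n0 : hermite R n != 0 by rewrite monic_neq0.
have sX : size ('X * hermite R n) = n.+2 by rewrite mulrC size_mulX // sn.
have lt : (size (- (hermite R n)^`()) < size ('X * hermite R n)%R)%N.
  rewrite size_polyN sX -sn ltnS; exact: ltnW (lt_size_deriv n0).
split; first by rewrite size_polyDl.
by rewrite monicE lead_coefDl // -monicE monicMr ?monicX.
Qed.

Lemma size_hermite (R : realType) (n : nat) : size (hermite R n) = n.+1.
Proof. by case: (size_hermite_monic R n). Qed.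

Lemma hermite_monic (R : realType) (n : nat) : hermite R n \is monic.
Proof. by case: (size_hermite_monic R n). Qed.

Lemma deriv_hermiteS (R : realType) (n : nat) :
  (hermite R n.+1)^`() = hermite R n *+ n.+1.
Proof.
elim: n => [|n IH]; first by rewrite /= derivC subr0 mulr1 derivX.
rewrite [hermite R n.+2]/= -/(hermite R n.+1) derivB derivM derivX mul1r.
rewrite IH derivMn [RHS]mulrS -addrA; congr (_ + _).
by rewrite mulrnAr -mulrnBl.
Qed.

Lemma hermite_ode (R : realType) (n : nat) :
  (hermite R n)^`()^`() - 'X * (hermite R n)^`() + hermite R n *+ n = 0.
Proof.
case: n => [|n]; first by rewrite /= derivC linear0 mulr0 subr0 mulr0n addr0.
rewrite deriv_hermiteS derivMn /= mulrnAr -mulrnBl -mulrnDl.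
by rewrite addrC addrA subrK subrr mul0rn.
Qed.

(* Main.v *)
Require Import Defs.
From mathcomp Require Import all_boot all_order all_algebra.
From mathcomp Require Import all_classical all_reals all_analysis.
From mathcomp Require Import ring lra zify.
Import Order.TTheory GRing.Theory Num.Theory.
Import numFieldNormedType.Exports.
Local Open Scope classical_set_scope.
Local Open Scope ring_scope.

(** For a power series F write [F(D)] for the corresponding differential operator
and consider the polynomials [F(D) exp(-D^2/2) x^n]. Free convolution multiplies
the operators, so with [c = 2^(-1/2)] the map [T_n] acts on this parametrization as
[F(t) |-> F(ct)^2], and the Hermite polynomial is the fixed point [F = 1]. On [M_n]
the coefficients of t and t^2 in F vanish, so to first order [T_n] multiplies
the coefficient of [t^k] by [2 c^k <= c], as k >= 3.

The perturbation in the direction [D^k] moves the i-th root of [He_n] by a multiple of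
[He_(n-k)(h_i) / He_n'(h_i)]. By the Christoffel-Darboux formula these vectors are
orthogonal, so the first-order contraction holds in the Euclidean norm of the root
vectors without any loss, and one step gives [e' <= c e (1 + C e)]. The potential
[e exp(B e)] turns this into the stated bound for all iterates. *)

Set Implicit Arguments.
Unset Strict Implicit.
Unset Printing Implicit Defensive.

(** * Hermite coefficients and the operator parametrization *)

Lemma hermiteSS (R : realType) (n : nat) :
  hermite R n.+2 = 'X * hermite R n.+1 - hermite R n *+ n.+1.
Proof. by rewrite -deriv_hermiteS. Qed.

(* The coefficient of [t^k] in [exp(-t^2/2)]. *)
Fixpoint gauss_coef (R : realType) (k : nat) : R :=
  match k with
  | 0 => 1
  | 1 => 0
  | k'.+2 => - gauss_coef R k' / k'.+2%:R
  end.

Lemma gauss_coefSS (R : realType) (k : nat) : k.+2%:R * gauss_coef R k.+2 = - gauss_coef R k.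
Proof. by rewrite /= mulrC divfK // pnatr_eq0. Qed.

(** Coefficientwise form of He_n = exp(-D^2/2) x^n. The induction on n = i + k follows the recursion
    He_(n+1) = x He_n - He_n'. *)
Lemma coef_hermite (R : realType) (i k : nat) :
  (hermite R (i + k))`_i * i`!%:R = (i + k)`!%:R * gauss_coef R k.
Proof.
move: {2}(i + k)%N (erefl (i + k)%N) => n; elim: n i k => [|n IH] i k.
  by move/eqP; rewrite addn_eq0 => /andP[/eqP-> /eqP->]; rewrite coef1.
move=> e; rewrite e /= coefB coefXM coef_deriv.
case: i e => [|i] /= e.
  rewrite add0n in e; rewrite {k}e sub0r; case: n IH => [|n] IH.
    by rewrite coef1 mul0rn oppr0 mul0r mulr0.
  have := IH 1%N n erefl; rewrite add1n fact0 => E1.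
  have E2 := gauss_coefSS R n; rewrite mulr1 in E1; rewrite mulr1n mulr1 E1 [in RHS]factS natrM.
  by rewrite (mulrC n.+2%:R) -mulrA E2 mulrN.
have en : n = (i + k)%N by lia.
have E0 := IH i k (esym en); rewrite -en in E0.
rewrite mulrBl [X in X - _](_ : _ = i.+1%:R * (n`!%:R * gauss_coef R k));
  last by rewrite factS natrM mulrCA E0.
case: k e en E0 => [|[|k]] e en E0.
- rewrite nth_default ?size_hermite; last by lia.
  by rewrite mul0rn mul0r subr0 en addn0 factS natrM !mulrA.
- rewrite nth_default ?size_hermite; last by lia.
  by rewrite mul0rn mul0r subr0 !mulr0.
have := IH i.+2 k.
have -> : (i.+2 + k)%N = n by lia.
move=> /(_ erefl) E1; have E2 := gauss_coefSS R k.
have -> : (hermite R n)`_i.+2 *+ i.+2 * (i.+1)`!%:R = n`!%:R * gauss_coef R k.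
  by rewrite -E1 [in RHS]factS natrM -mulr_natr; ring.
(* The multiplication by x contributes the weight i+1 and the derivative, through the recursion of
   [gauss_coef], the weight k+2. They add up to n+1. *)
rewrite -[gauss_coef R k]opprK -E2 factS natrM.
have -> : n.+1%:R = i.+1%:R + k.+2%:R :> R by rewrite -natrD; congr _%:R; lia.
ring.
Qed.

(* [F(D) exp(-D^2/2) x^n], as [D^j He_n = n!/(n-j)! He_(n-j)]. *)
Definition hermite_op (R : realType) (n : nat) (F : {poly R}) : {poly R} :=
  \sum_(j < n.+1) (F`_j * (n`!%:R / (n - j)`!%:R)) *: hermite R (n - j).

Lemma fact_neq0 (R : realType) (n : nat) : n`!%:R != 0 :> R.
Proof. by rewrite pnatr_eq0 -lt0n fact_gt0. Qed.

(** exp(-t^2/2) truncated after t^n, which acts in the same way on degree at most n. *)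
Definition gauss_poly (R : realType) (n : nat) : {poly R} := \poly_(k < n.+1) gauss_coef R k.

Lemma size_hermite_op (R : realType) (n : nat) (F : {poly R}) : (size (hermite_op n F) <= n.+1)%N.
Proof.
apply: (leq_trans (size_sum _ _ _)); apply/bigmax_leqP => j _.
by rewrite (leq_trans (size_scale_leq _ _)) // size_hermite ltnS leq_subr.
Qed.

(** Composing F(D) with exp(-D^2/2) multiplies the symbols, and D^k x^n = n!/(n-k)! x^(n-k). *)
Lemma coef_hermite_op (R : realType) (n : nat) (F : {poly R}) (k : nat) : (k <= n)%N ->
  (hermite_op n F)`_(n - k) * (n - k)`!%:R = n`!%:R * (F * gauss_poly R n)`_k.
Proof.
move=> kn; rewrite coef_sum coefM mulr_suml.
rewrite (bigID (fun j : 'I_n.+1 => (j < k.+1)%N)) /= [X in _ + X]big1 ?addr0; last first.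
  move=> j; rewrite -leqNgt => kj.
  rewrite coefZ [(hermite _ _)`_ _]nth_default ?mulr0 ?mul0r //.
  by rewrite size_hermite; have := ltn_ord j; lia.
rewrite -(big_ord_widen n.+1 (fun j =>
  ((F`_j * (n`!%:R / (n - j)`!%:R)) *: hermite R (n - j))`_(n - k) * (n - k)`!%:R)) //.
rewrite mulr_sumr; apply: eq_bigr => j _.
have jk : (j <= k)%N by have := ltn_ord j; rewrite ltnS.
rewrite coefZ coef_poly ltnS (leq_trans (leq_subr _ _) kn).
have /esym E := coef_hermite R (n - k) (k - j).
rewrite (_ : n - k + (k - j) = n - j)%N in E; last by lia.
rewrite -mulrA -E.
have := fact_neq0 R (n - j); set x := _%:R => x0; field.
exact: x0.
Qed.

(* Coefficient of [D^k] in the operator [P(D)] such that [p = P(D) x^n]. *)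
Definition ncoef (R : realType) (n : nat) (p : {poly R}) (k : nat) : R :=
  p`_(n - k) * (n - k)`!%:R / n`!%:R.

Lemma ncoef_hermite_op (R : realType) (n : nat) (F : {poly R}) (k : nat) : (k <= n)%N ->
  ncoef n (hermite_op n F) k = (F * gauss_poly R n)`_k.
Proof. by move=> kn; rewrite /ncoef coef_hermite_op // mulrAC mulfV ?mul1r ?fact_neq0. Qed.

Lemma ncoef_inj (R : realType) (n : nat) (p q : {poly R}) :
  (size p <= n.+1)%N -> (size q <= n.+1)%N ->
  (forall k, (k <= n)%N -> ncoef n p k = ncoef n q k) -> p = q.
Proof.
move=> sp sq E; apply/polyP => i; case: (leqP i n) => [lin|ltni]; last first.
  by rewrite !nth_default // (leq_trans _ ltni).
have := E _ (leq_subr i n); rewrite /ncoef subKn //.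
by move/(mulIf (invr_neq0 (fact_neq0 R n)))/(mulIf (fact_neq0 R i)).
Qed.

(** * Free convolution and dilation acting on operator symbols *)

Lemma size_boxplus (R : realType) (n : nat) (p q : {poly R}) :
  (size (boxplus n p q) <= n.+1)%N.
Proof.
apply: (leq_trans (size_sum _ _ _)); apply/bigmax_leqP => j _.
by rewrite (leq_trans (size_scale_leq _ _)) // size_polyXn ltnS leq_subr.
Qed.

(** The factorial weights of the convolution are absorbed by the normalization and its signs cancel.
    What remains is a Cauchy product, so the operators multiply. *)
Lemma ncoef_boxplus (R : realType) (n : nat) (p q : {poly R}) (k : nat) : (k <= n)%N ->
  ncoef n (boxplus n p q) k = \sum_(i < k.+1) ncoef n p i * ncoef n q (k - i).
Proof.
move=> kn; rewrite /ncoef coef_sum (bigD1 (inord k)) //= big1 ?addr0; last first.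
  move=> i; rewrite -val_eqE /= inordK ?ltnS // => ik; rewrite coefZ coefXn.
  by case: eqP => // e; [have := ltn_ord i; move/eqP: ik; lia | rewrite mulr0].
rewrite coefZ coefXn inordK ?ltnS // eqxx mulr1 /boxplus_coef.
rewrite mulr_sumr !mulr_suml.
rewrite (bigID (fun j : 'I_n.+1 => (j < k.+1)%N)) /= [X in _ + X]big1 ?addr0; last first.
  by move=> j jk; rewrite big_pred0 ?mulr0 ?mul0r // => i; apply/eqP; lia.
rewrite -(big_ord_widen n.+1 (fun i => (-1) ^+ k * (\sum_(j < n.+1 | (i + j == k)%N)
    (((n - i)`! * (n - j)`!)%:R / (n`! * (n - k)`!)%:R)
      * acoef n p i * acoef n q j) * (n - k)`!%:R / n`!%:R)) //.
apply: eq_bigr => i _; have ik : (i <= k)%N by rewrite -ltnS.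
rewrite (bigD1 (inord (k - i))) /=; last by rewrite inordK; [apply/eqP|]; lia.
rewrite big1 ?addr0; last first.
  by move=> j /andP[/eqP e]; rewrite -val_eqE /= inordK => [/eqP|]; lia.
rewrite inordK; last by lia.
have s2 : (-1) ^+ k * (-1) ^+ i * (-1) ^+ (k - i) = 1 :> R.
  by rewrite -mulrA -exprD subnKC // -exprD addnn -mul2n exprM sqrrN !expr1n.
rewrite /acoef !natrM.
set a := (-1) ^+ k in s2 *; set b := (-1) ^+ i in s2 *; set d := (-1) ^+ _ in s2 *.
have n0 := fact_neq0 R n; have nk0 := fact_neq0 R (n - k).
set p' := p`_ _; set q' := q`_ _.
set N := n`!%:R in n0 *; set M := (n - k)`!%:R in nk0 *.
set X := (_)`!%:R; set Y := (_ - (_ - _))`!%:R.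
transitivity ((a * b * d) * (p' * X / N * (q' * Y / N))); last by rewrite s2 mul1r.
by field; rewrite n0 nk0.
Qed.

Lemma coef_comp_scaleX (R : realType) (c : R) (p : {poly R}) (k : nat) :
  (p \Po (c *: 'X))`_k = c ^+ k * p`_k.
Proof.
rewrite comp_polyE coef_sum.
under eq_bigr => i _ do rewrite exprZn coefZ coefZ coefXn.
case: (ltnP k (size p)) => [kp|kp]; last first.
  rewrite [p`_k]nth_default // mulr0 big1 // => i _.
  by rewrite (_ : (k == i) = false) ?mulr0 //; apply/eqP; have := ltn_ord i; lia.
rewrite (bigD1 (Ordinal kp)) //= eqxx mulr1 big1 ?addr0; last first.
  by move=> i; rewrite -val_eqE /= => ik; rewrite eq_sym (negbTE ik) !mulr0.
exact: mulrC.
Qed.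

Lemma coef_dilation (R : realType) (n : nat) (c : R) (f : {poly R}) (k : nat) :
  c != 0 -> (k <= n)%N -> (dilation n c f)`_(n - k) = c ^+ k * f`_(n - k).
Proof.
move=> c0 kn; rewrite coefZ coef_comp_scaleX mulrA; congr (_ * _).
by rewrite -{1}(subnKC kn) exprD exprVn mulfK // expf_neq0.
Qed.

Lemma size_dilation (R : realType) (n : nat) (c : R) (f : {poly R}) :
  (size (dilation n c f) <= size f)%N.
Proof.
apply/leq_sizeP => j fj.
by rewrite coefZ coef_comp_scaleX nth_default // !mulr0.
Qed.

(** For g = exp(-t^2/2) this compares coefficients in (g^2)' = -2t g^2. The sum S comes from
    differentiating one factor; reversing the index gives the other. *)
Lemma gauss_coef_convSS (R : realType) (k : nat) :
  k.+2%:R * (\sum_(i < k.+3) gauss_coef R i * gauss_coef R (k.+2 - i)) =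
  - 2 * \sum_(i < k.+1) gauss_coef R i * gauss_coef R (k - i).
Proof.
pose S := \sum_(i < k.+3) i%:R * (gauss_coef R i * gauss_coef R (k.+2 - i)).
have SE : S = - \sum_(i < k.+1) gauss_coef R i * gauss_coef R (k - i).
  rewrite /S 2!big_ord_recl /= mul0r !mul0r mulr0 !add0r -sumrN.
  apply: eq_bigr => i _; rewrite /bump /= !add1n subSS subSS mulrA.
  by rewrite -[X in _ * X * _]/(gauss_coef R i.+2) gauss_coefSS mulNr.
have SE' : S = \sum_(i < k.+3) (k.+2 - i)%:R * (gauss_coef R i * gauss_coef R (k.+2 - i)).
  rewrite [RHS](reindex_inj rev_ord_inj) /=; apply: eq_bigr => i _.
  rewrite subSS subKn; last by rewrite -ltnS.
  by rewrite [gauss_coef R (_ - _) * _]mulrC.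
rewrite mulr_sumr (eq_bigr (fun i : 'I_k.+3 => i%:R * (gauss_coef R i * gauss_coef R (k.+2 - i)) +
   (k.+2 - i)%:R * (gauss_coef R i * gauss_coef R (k.+2 - i)))).
  by rewrite big_split /= -SE' -/S SE mulNr mulr2n !mulrDl !mul1r opprD.
by move=> i _; rewrite -mulrDl -natrD subnKC // -ltnS.
Qed.

(** The identity g(ct)^2 = g(t) for g = exp(-t^2/2), which makes He_n a fixed point. *)
Lemma gauss_coef_conv (R : realType) (c : R) (k : nat) : c ^+ 2 = 2^-1 ->
  c ^+ k * (\sum_(i < k.+1) gauss_coef R i * gauss_coef R (k - i)) = gauss_coef R k.
Proof.
(* The recursion has step two, so two consecutive indices are carried along. *)
move=> c2; suff [] :
  c ^+ k * (\sum_(i < k.+1) gauss_coef R i * gauss_coef R (k - i)) = gauss_coef R k /\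
  c ^+ k.+1 * (\sum_(i < k.+2) gauss_coef R i * gauss_coef R (k.+1 - i)) = gauss_coef R k.+1 by [].
elim: k => [|k [IH1 IH2]].
  by rewrite expr0 !big_ord_recl !big_ord0 /= !(mulr0, mul0r, addr0, mulr1).
split=> //; apply: (mulfI (_ : k.+2%:R != 0)); first by rewrite pnatr_eq0.
rewrite mulrCA gauss_coef_convSS gauss_coefSS -IH1 -addn2 exprD c2.
rewrite mulrA -[RHS]mulNr; congr (_ * _).
by rewrite -mulrA mulrN mulVf ?mulrN1 // pnatr_eq0.
Qed.

Lemma coef_gauss_poly (R : realType) (n k : nat) : (k <= n)%N -> (gauss_poly R n)`_k = gauss_coef R k.
Proof. by move=> kn; rewrite coef_poly ltnS kn. Qed.

(** The symbol of the convolution is F G g^2, and dilation substitutes ct for t. As g(ct)^2 = g(t),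
    one Gaussian factor is left and (F G)(ct) is the new symbol. *)
Lemma hermite_op_dilation_boxplus (R : realType) (n : nat) (c : R) (F G : {poly R}) :
  c ^+ 2 = 2^-1 ->
  dilation n c (boxplus n (hermite_op n F) (hermite_op n G)) = hermite_op n ((F * G) \Po (c *: 'X)).
Proof.
move=> c2; have c0 : c != 0.
  by apply: contra_eq_neq c2 => ->; rewrite expr0n eq_sym invr_eq0 pnatr_eq0.
apply: (@ncoef_inj _ n); last move=> k kn.
- exact: leq_trans (size_dilation _ _ _) (size_boxplus _ _ _).
- exact: size_hermite_op.
rewrite ncoef_hermite_op // {1}/ncoef coef_dilation // -!mulrA !(mulrA _`_ _) -/(ncoef _ _ _).
rewrite ncoef_boxplus //.
pose g := gauss_poly R n.
transitivity (c ^+ k * ((F * G) * (g * g))`_k).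
  congr (_ * _); rewrite mulrACA coefM; apply: eq_bigr => i _.
  have ik : (i <= k)%N by rewrite -ltnS.
  by rewrite !ncoef_hermite_op // (leq_trans _ kn) // leq_subr.
rewrite !coefM mulr_sumr; apply: eq_bigr => i _.
have ik : (i <= k)%N by rewrite -ltnS.
rewrite coef_comp_scaleX coef_gauss_poly ?(leq_trans (leq_subr _ _)) //.
rewrite -(gauss_coef_conv (k - i) c2) -{1}(subnKC ik) exprD mulrACA; congr (_ * (_ * _)).
rewrite coefM; apply: eq_bigr => j _.
by rewrite !coef_gauss_poly //; have := ltn_ord j; lia.
Qed.

Lemma horner_hermiteSS (R : realType) (n : nat) (x : R) :
  (hermite R n.+2).[x] = x * (hermite R n.+1).[x] - n.+1%:R * (hermite R n).[x].
Proof. by rewrite hermiteSS hornerD hornerM hornerX hornerN hornerMn mulr_natl. Qed.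

Lemma horner_deriv_hermiteSS (R : realType) (n : nat) (x : R) :
  (hermite R n.+2)^`().[x] = (hermite R n.+1).[x] + x * (hermite R n.+1)^`().[x]
    - n.+1%:R * (hermite R n)^`().[x].
Proof.
rewrite hermiteSS derivB derivM derivX mul1r derivMn.
by rewrite hornerD hornerD hornerM hornerX hornerN hornerMn mulr_natl.
Qed.

(** * Christoffel-Darboux formulas *)

Lemma hermite_CD_diff (R : realType) (n : nat) (x y : R) :
  (x - y) * (\sum_(m < n.+1) (hermite R m).[x] * (hermite R m).[y] / m`!%:R) =
  ((hermite R n.+1).[x] * (hermite R n).[y] - (hermite R n).[x] * (hermite R n.+1).[y])
    / n`!%:R.
Proof.
elim: n => [|n IH].
  by rewrite big_ord_recl big_ord0 /= derivC !hornerE /=; field.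
rewrite big_ord_recr mulrDr IH !horner_hermiteSS factS natrM /= -/(hermite R n.+1).
have := fact_neq0 R n; have : n.+1%:R != 0 :> R by rewrite pnatr_eq0.
move: (n`!%:R) (n.+1%:R) (hermite R n.+1).[x] (hermite R n.+1).[y]
  (hermite R n).[x] (hermite R n).[y] => a b X1 Y1 X Y.
by move=> b0 a0; field; rewrite b0 a0.
Qed.

Lemma hermite_CD_same (R : realType) (n : nat) (x : R) :
  \sum_(m < n.+1) (hermite R m).[x] ^+ 2 / m`!%:R =
  ((hermite R n.+1)^`().[x] * (hermite R n).[x] - (hermite R n)^`().[x] * (hermite R n.+1).[x])
    / n`!%:R.
Proof.
elim: n => [|n IH].
  by rewrite big_ord_recl big_ord0 /= derivC subr0 mulr1 derivX !hornerE /=; field.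
rewrite big_ord_recr IH horner_hermiteSS horner_deriv_hermiteSS factS natrM /=.
have := fact_neq0 R n; have : n.+1%:R != 0 :> R by rewrite pnatr_eq0.
rewrite -/(hermite R n.+1).
move: (n`!%:R) (n.+1%:R) (hermite R n.+1).[x] (hermite R n.+1)^`().[x]
  (hermite R n).[x] (hermite R n)^`().[x] => a b X1 Y1 X Y.
by move=> b0 a0; field; rewrite b0 a0.
Qed.

Lemma hermite_root_orth (R : realType) (n : nat) (x y : R) : x != y ->
  (hermite R n).[x] = 0 -> (hermite R n).[y] = 0 ->
  \sum_(m < n) (hermite R m).[x] * (hermite R m).[y] / m`!%:R = 0.
Proof.
move=> xy; case: n => [|n] ex ey; first by rewrite big_ord0.
apply: (mulfI (_ : x - y != 0)); first by rewrite subr_eq0.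
by rewrite hermite_CD_diff ex ey mul0r mulr0 subr0 mul0r mulr0.
Qed.

Lemma hermite_root_norm (R : realType) (n : nat) (x : R) :
  (hermite R n).[x] = 0 -> (hermite R n)^`().[x] != 0 ->
  \sum_(m < n) (hermite R m).[x] ^+ 2 / m`!%:R = (hermite R n)^`().[x] ^+ 2 / n`!%:R.
Proof.
case: n => [|n] e; first by rewrite derivC horner0 eqxx.
rewrite hermite_CD_same e mulr0 subr0 deriv_hermiteS hornerMn -mulr_natr.
rewrite mulf_eq0 negb_or factS natrM => /andP[x0 n0].
have := fact_neq0 R n; move: n0.
move: (n`!%:R) (n.+1%:R) (_.[_]) => a b c b0 a0; field.
by rewrite a0 b0.
Qed.

(** * Orthogonality at the roots of a Hermite polynomial *)

Lemma horner_polyr (R : realType) (n : nat) (r : 'rV[R]_n) (x : R) :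
  (polyr r).[x] = \prod_(j < n) (x - r 0 j).
Proof. by rewrite /polyr horner_prod; apply: eq_bigr => j _; rewrite hornerXsubC. Qed.

Lemma deriv_polyr (R : realType) (n : nat) (r : 'rV[R]_n) (i : 'I_n) :
  (polyr r)^`().[r 0 i] = \prod_(j < n | j != i) (r 0 i - r 0 j).
Proof.
rewrite /polyr (bigD1 i) //= derivM derivXsubC mul1r hornerD hornerM hornerXsubC subrr.
rewrite mul0r addr0 horner_prod; apply: eq_bigr => j _; exact: hornerXsubC.
Qed.

Lemma increasing_inj (R : realType) (n : nat) (r : 'rV[R]_n) :
  increasing r -> injective (r 0).
Proof.
move=> ir i j e; apply/val_inj/eqP; case: (ltngtP i j) => // /ir;
  by rewrite e ltxx.
Qed.

Section HermiteRoots.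
Variables (R : realType) (n : nat) (h : 'rV[R]_n).
Hypotheses (inc_h : increasing h) (hE : polyr h = hermite R n).

Definition hermite_slope (i : 'I_n) : R := (hermite R n)^`().[h 0 i].

Lemma hermite_slope_neq0 i : hermite_slope i != 0.
Proof.
rewrite /hermite_slope -hE deriv_polyr; apply/prodf_neq0 => j ji.
by rewrite subr_eq0; apply: contra ji => /eqP/(increasing_inj inc_h)->.
Qed.

Lemma root_hermite i : (hermite R n).[h 0 i] = 0.
Proof. by rewrite -hE horner_polyr (bigD1 i) //= subrr mul0r. Qed.

Definition orth_weight (k : nat) : R := n`!%:R / (n - k.+1)`!%:R.

Lemma orth_weight_ge0 k : 0 <= orth_weight k. Proof. by rewrite divr_ge0 ?ler0n. Qed.

(* Minus the velocity of the i-th root under a perturbation by [He_(n-k-1)]. *)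
Definition orth_vec (k : nat) (i : 'I_n) : R := (hermite R (n - k.+1)).[h 0 i] / hermite_slope i.

(** The Christoffel-Darboux sums at the roots, divided by the slopes: off the diagonal they vanish,
    and on it the confluent formula gives the squared slope over n!. *)
Lemma orth_vec_orth (i j : 'I_n) : \sum_(k < n) orth_weight k * orth_vec k i * orth_vec k j = (i == j)%:R.
Proof.
rewrite /orth_weight /orth_vec.
transitivity (n`!%:R / (hermite_slope i * hermite_slope j) *
  \sum_(m < n) (hermite R m).[h 0 i] * (hermite R m).[h 0 j] / m`!%:R).
  rewrite [RHS]mulr_sumr (reindex_inj rev_ord_inj) /=; apply: eq_bigr => k _.
  rewrite (_ : n - (n - k.+1).+1 = k)%N; last by have := ltn_ord k; lia.
  have := fact_neq0 R k; have := hermite_slope_neq0 i; have := hermite_slope_neq0 j.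
  move: (hermite_slope i) (hermite_slope j) (k`!%:R) => a b c a0 b0 c0; field.
  by rewrite a0 b0 c0.
have [<-|ij] := eqVneq i j; last first.
  have hij : h 0 i != h 0 j by apply: contra ij => /eqP/(increasing_inj inc_h)->.
  by rewrite hermite_root_orth ?root_hermite ?mulr0.
under eq_bigr do rewrite -expr2.
rewrite ?eqxx hermite_root_norm ?root_hermite ?hermite_slope_neq0 // -/(hermite_slope i).
have := fact_neq0 R n; have := hermite_slope_neq0 i; move: (hermite_slope i) (n`!%:R) => a b a0 b0.
by rewrite mulr1n; field; rewrite a0 b0.
Qed.

(** A one-sided inverse of a square matrix is two-sided, so orthogonality passes from the root index
    to the degree index. In particular [orth_weight l] is the inverse squared norm of
    [orth_vec l]. *)
Lemma orth_vec_dual (k l : 'I_n) : \sum_(i < n) orth_vec k i * orth_vec l i * orth_weight l = (k == l)%:R.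
Proof.
pose A : 'M[R]_n := \matrix_(i, k) (orth_vec k i * orth_weight k).
pose B : 'M[R]_n := \matrix_(k, i) orth_vec k i.
have AB : A *m B = 1%:M.
  apply/matrixP => i j; rewrite !mxE -orth_vec_orth; apply: eq_bigr => m _.
  by rewrite !mxE (mulrC (orth_vec m i)).
have /matrixP/(_ k l) := mulmx1C AB; rewrite !mxE => <-.
by apply: eq_bigr => i _; rewrite !mxE -mulrA.
Qed.

Definition orth_coord (k : nat) (u : 'I_n -> R) : R := \sum_(i < n) orth_vec k i * u i.

Lemma orth_coord_inv (u : 'I_n -> R) (i : 'I_n) :
  \sum_(k < n) orth_weight k * orth_vec k i * orth_coord k u = u i.
Proof.
under eq_bigr do rewrite mulr_sumr.
rewrite exchange_big /= (bigD1 i) //= [X in _ + X]big1 ?addr0.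
  under eq_bigr => k _ do rewrite (mulrA (orth_weight k * _)).
  by rewrite -mulr_suml orth_vec_orth eqxx mul1r.
move=> j ji; under eq_bigr => k _ do rewrite (mulrA (orth_weight k * _)).
by rewrite -mulr_suml orth_vec_orth eq_sym (negbTE ji) mul0r.
Qed.

Lemma orth_coord_synth (a : nat -> R) (k : 'I_n) :
  orth_coord k (fun i => \sum_(l < n) orth_weight l * orth_vec l i * a l) = a k.
Proof.
rewrite /orth_coord; under eq_bigr do rewrite mulr_sumr.
rewrite exchange_big /= (bigD1 k) //= [X in _ + X]big1 ?addr0.
  rewrite (eq_bigr (fun i => orth_vec k i * orth_vec k i * orth_weight k * a k)) => [|i _]; last by ring.
  by rewrite -mulr_suml orth_vec_dual eqxx mul1r.
move=> l lk.
rewrite (eq_bigr (fun i => orth_vec k i * orth_vec l i * orth_weight l * a l)) => [|i _]; last by ring.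
by rewrite -mulr_suml orth_vec_dual eq_sym (negbTE lk) mul0r.
Qed.

(** Parseval's identity: a contraction of the coordinates is one of the Euclidean norm, without loss
    of a constant. *)
Lemma orth_coord_parseval (u : 'I_n -> R) :
  \sum_(i < n) u i ^+ 2 = \sum_(k < n) orth_weight k * orth_coord k u ^+ 2.
Proof.
under eq_bigr => i _ do rewrite expr2 -{1}(orth_coord_inv u i) mulr_suml.
rewrite exchange_big /=; apply: eq_bigr => k _.
rewrite expr2 [RHS]mulrA {3}/orth_coord mulr_sumr; apply: eq_bigr => i _; ring.
Qed.

(** Both sides have degree below n and agree at the n distinct roots of He_n. *)
Lemma hermite_interpolation (p : {poly R}) : (size p <= n)%N ->
  p = \sum_(k < n) (orth_weight k * orth_coord k (fun j => p.[h 0 j] / hermite_slope j)) *: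
        hermite R (n - k.+1).
Proof.
move=> sp; apply/eqP; rewrite -subr_eq0; apply/eqP.
set q := \sum_(k < n) _.
apply: (@roots_geq_poly_eq0 _ _ [seq h 0 i | i <- enum 'I_n]).
- apply/allP => x /mapP[i _ ->]; rewrite /root hornerD hornerN horner_sum subr_eq0.
  under eq_bigr do rewrite hornerZ.
  rewrite -(divfK (hermite_slope_neq0 i) (p.[h 0 i])) -(orth_coord_inv (fun j => p.[h 0 j] / hermite_slope j) i).
  rewrite mulr_suml; apply/eqP/eq_bigr => k _; rewrite /orth_vec.
  by have := hermite_slope_neq0 i; move: (hermite_slope i) (orth_coord _ _) => a b a0; field.
- by rewrite map_inj_uniq ?enum_uniq //; apply: increasing_inj.
rewrite size_map size_enum_ord (leq_trans (size_polyD _ _)) // geq_max sp size_polyN.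
apply: (leq_trans (size_sum _ _ _)); apply/bigmax_leqP => k _.
rewrite (leq_trans (size_scale_leq _ _)) // size_hermite; have := ltn_ord k; lia.
Qed.

Lemma hermite_op_recl (F : {poly R}) : F`_0 = 1 ->
  hermite_op n F = hermite R n + \sum_(k < n) (orth_weight k * F`_k.+1) *: hermite R (n - k.+1).
Proof.
move=> F0; rewrite /hermite_op big_ord_recl /= F0 subn0 mul1r divff ?fact_neq0 // scale1r.
by congr (_ + _); apply: eq_bigr => k _; rewrite /bump /= add1n mulrC.
Qed.

(** The difference p - He_n has degree below n and the values of p at the roots of He_n, so
    interpolating it yields the symbol. *)
Lemma monic_hermite_op (p : {poly R}) : p \is monic -> size p = n.+1 ->
  p = hermite_op n (\poly_(k < n.+1)
    (if k is k'.+1 then orth_coord k' (fun j => p.[h 0 j] / hermite_slope j) else 1)).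
Proof.
move=> mp sp; rewrite hermite_op_recl ?coef_poly //.
have sq : (size (p - hermite R n)%R <= n)%N.
  apply/leq_sizeP => j; rewrite leq_eqVlt => /orP[/eqP<-|nj]; rewrite coefB.
    have := monicP mp; have := monicP (hermite_monic R n).
    by rewrite /lead_coef sp size_hermite /= => -> ->; rewrite subrr.
  by rewrite !nth_default ?subrr // ?size_hermite ?sp.
apply/eqP; rewrite addrC -subr_eq; apply/eqP.
rewrite [LHS](hermite_interpolation sq); apply: eq_bigr => k _.
rewrite coef_poly ltnS ltn_ord; congr (_ * _ *: _); apply: eq_bigr => i _.
by rewrite hornerD hornerN root_hermite subr0.
Qed.

End HermiteRoots.

(** * The constraints of [Mn] as conditions on leading coefficients and symbols *)

Lemma coef_prod_XsubC2 (R : realType) (s : seq R) (k : nat) : size s = k.+2 ->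
  2 * (\prod_(x <- s) ('X - x%:P))`_k = (\sum_(x <- s) x) ^+ 2 - \sum_(x <- s) x ^+ 2.
Proof.
elim: s k => [//|x s IH] k [sk]; rewrite !big_cons mulrBl coefB coefXM coefCM.
have := @coefPn_prod_XsubC R s; rewrite sk /= => -> //.
case: k sk => [|k] sk.
  case: s sk {IH} => [//|y [|//]] _; rewrite !big_seq1 /=; ring.
rewrite mulrBr /= (IH _ sk); ring.
Qed.

Lemma polyr_seq (R : realType) (n : nat) (r : 'rV[R]_n) :
  polyr r = \prod_(x <- [seq r 0 i | i <- enum 'I_n]) ('X - x%:P).
Proof. by rewrite big_map big_enum. Qed.

Lemma size_polyr (R : realType) (n : nat) (r : 'rV[R]_n) : size (polyr r) = n.+1.
Proof. by rewrite polyr_seq size_prod_XsubC size_map size_enum_ord. Qed.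

Lemma monic_polyr (R : realType) (n : nat) (r : 'rV[R]_n) : polyr r \is monic.
Proof. exact: monic_prod_XsubC. Qed.

Lemma polyr_coef_eq (R : realType) (n : nat) (r s : 'rV[R]_n) : (2 <= n)%N ->
  \sum_i r 0 i = \sum_i s 0 i -> \sum_i r 0 i ^+ 2 = \sum_i s 0 i ^+ 2 ->
  forall k, (k <= 2)%N -> (polyr r)`_(n - k) = (polyr s)`_(n - k).
Proof.
move=> n2 e1 e2 [|[|[|//]]] _.
- have := monicP (monic_polyr r); have := monicP (monic_polyr s).
  by rewrite /lead_coef !size_polyr /= subn0 => -> ->.
- have C (u : 'rV[R]_n) : (polyr u)`_(n - 1) = - \sum_i u 0 i.
    rewrite polyr_seq; have := @coefPn_prod_XsubC R [seq u 0 i | i <- enum 'I_n].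
    rewrite size_map size_enum_ord subn1 => -> //; last by case: (n) n2.
    by rewrite big_map big_enum.
  by rewrite !C e1.
have C (u : 'rV[R]_n) : 2 * (polyr u)`_(n - 2) = (\sum_i u 0 i) ^+ 2 - \sum_i u 0 i ^+ 2.
  rewrite polyr_seq coef_prod_XsubC2; last by rewrite size_map size_enum_ord; lia.
  have S (f : R -> R) : \sum_(x <- [seq u 0 i | i <- enum 'I_n]) f x = \sum_i f (u 0 i).
    by rewrite big_map big_enum.
  by rewrite (S (fun x => x)) (S (fun x => x ^+ 2)).
by apply: (mulfI (_ : 2 != 0)); rewrite ?pnatr_eq0 // !C e1 e2.
Qed.

Lemma hermite_op1 (R : realType) (n : nat) : hermite_op n 1 = hermite R n.
Proof.
rewrite hermite_op_recl ?coef1 // big1 ?addr0 // => k _.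
by rewrite coef1 mulr0 scale0r.
Qed.

(** The products F g and g agree up to t^2. As g has constant term 1, this triangular system gives
    first F_1 = 0 and then F_2 = 0. *)
Lemma hermite_op_coef12 (R : realType) (n : nat) (F : {poly R}) : (2 <= n)%N -> F`_0 = 1 ->
  (forall k, (k <= 2)%N -> (hermite_op n F)`_(n - k) = (hermite R n)`_(n - k)) ->
  F`_1 = 0 /\ F`_2 = 0.
Proof.
move=> n2 F0 E.
have E' k : (k <= 2)%N -> (F * gauss_poly R n)`_k = (1 * gauss_poly R n)`_k.
  move=> k2; have kn := leq_trans k2 n2.
  by rewrite -!ncoef_hermite_op // hermite_op1 /ncoef E.
have g0 : (gauss_poly R n)`_0 = 1 by rewrite coef_gauss_poly.
have := E' 1%N isT; rewrite mul1r coefM !big_ord_recl big_ord0 /= F0 g0 mul1r mulr1 addr0.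
rewrite /bump /= subn0 addn0 addrC => /eqP; rewrite -subr_eq0 addrK => /eqP F1.
split=> //.
have := E' 2%N isT; rewrite mul1r coefM !big_ord_recl big_ord0 /= F0 /bump /=.
rewrite subn0 !addn0 F1 mul0r add0r addr0 addn1 subnn g0 mul1r mulr1 addrC => /eqP.
by rewrite -subr_eq0 addrK => /eqP.
Qed.

(** * A real root near its Newton approximation *)

Lemma horner_taylor1 (R : realType) (m : nat) (Q : {poly R}) (K t : R) :
  (size Q <= m.+2)%N -> (forall k, `|Q`_k| <= K) -> `|t| <= 1 ->
  `|Q.[t] - Q`_0 - Q`_1 * t| <= t ^+ 2 * (m%:R * K).
Proof.
move=> sQ QK t1; rewrite (horner_coef_wide t sQ) 2!big_ord_recl /= expr0 mulr1 expr1.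
set S := \sum_(i < m) _; rewrite /bump /= ?addn0 ?expr1 ?mulr1.
rewrite (_ : _ - _ - _ = S); last by ring.
apply: (le_trans (ler_norm_sum _ _ _)).
rewrite (_ : t ^+ 2 * _ = \sum_(i < m) t ^+ 2 * K); last first.
  by rewrite sumr_const card_ord -[in RHS]mulr_natl mulrCA.
apply: ler_sum => i _; rewrite /bump /= !add1n normrM normrX.
rewrite -[i.+2]add2n exprD -normrX (ger0_norm (sqr_ge0 t)) mulrCA.
rewrite ler_wpM2l ?sqr_ge0 // -[leRHS]mulr1 ler_pM ?exprn_ge0 //.
by rewrite exprn_ile1.
Qed.

(** For |t| <= (K+1)e the value Q(t) differs from Q_0 + t by at most C e^2, so Q changes sign within
    C e^2 of -Q_0. In C, the term K(K+1) pays for the slope error and the other for the degrees from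
    2 on. The bound C e <= 1 keeps the interval inside the range considered. *)
Lemma quadratic_root_approx (R : realType) (m : nat) (Q : {poly R}) (K e C : R) :
  (size Q <= m.+2)%N -> 0 <= e ->
  `|Q`_0| <= K * e -> `|Q`_1 - 1| <= K * e -> (forall k, `|Q`_k| <= K) ->
  C = K * (K + 1) + (K + 1) ^+ 2 * (m%:R * K) -> C * e <= 1 -> (K + 1) * e <= 1 ->
  exists2 t, root Q t & `|t + Q`_0| <= C * e ^+ 2.
Proof.
move=> sQ e0 Q0 Q1 QK CE Ce Ke.
have K0 : 0 <= K := le_trans (normr_ge0 _) (QK 0%N).
have mK : 0 <= m%:R * K by rewrite mulr_ge0.
have C0 : 0 <= C by rewrite CE addr_ge0 // mulr_ge0 // ?sqr_ge0 // addr_ge0.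
have Ce2 : C * e ^+ 2 <= e by rewrite expr2 mulrA ler_piMl.
have Ce20 : 0 <= C * e ^+ 2 by rewrite mulr_ge0 ?sqr_ge0.
have step t : `|t| <= (K + 1) * e -> `|Q.[t] - (Q`_0 + t)| <= C * e ^+ 2.
  move=> te; have t1 := le_trans te Ke.
  have := horner_taylor1 sQ QK t1.
  have A : t ^+ 2 * (m%:R * K) <= (K + 1) ^+ 2 * (m%:R * K) * e ^+ 2.
    rewrite [leRHS]mulrAC ler_wpM2r // -exprMn -[t ^+ 2]ger0_norm ?sqr_ge0 // normrX.
    by rewrite lerXn2r ?nnegrE // (le_trans _ te).
  have B : `|(Q`_1 - 1) * t| <= K * (K + 1) * e ^+ 2.
    rewrite normrM (_ : K * _ * _ = K * e * ((K + 1) * e)); last by ring.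
    by rewrite ler_pM.
  move=> D.
  rewrite (_ : Q.[t] - _ = (Q.[t] - Q`_0 - Q`_1 * t) + (Q`_1 - 1) * t); last by ring.
  rewrite (le_trans (ler_normD _ _)) // CE [leRHS]mulrDl [leRHS]addrC lerD //.
  exact: le_trans D A.
have near (s : R) : `|s| <= C * e ^+ 2 -> `|- Q`_0 + s| <= (K + 1) * e.
  move=> sC; rewrite (le_trans (ler_normD _ _)) // normrN mulrDl mul1r lerD //.
  exact: le_trans sC Ce2.
have [] := @poly_ivt R Q (- Q`_0 - C * e ^+ 2) (- Q`_0 + C * e ^+ 2).
- by rewrite lerD2l (le_trans _ Ce20) // oppr_le0.
- apply/andP; split.
    have /step : `|- Q`_0 - C * e ^+ 2| <= (K + 1) * e by apply: near; rewrite normrN ger0_norm.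
    by rewrite ler_norml => /andP[_]; rewrite addrA subrr add0r opprK gerDr.
  have /step : `|- Q`_0 + C * e ^+ 2| <= (K + 1) * e by apply: near; rewrite ger0_norm.
  by rewrite ler_norml => /andP[+ _]; rewrite addrA subrr add0r lerBrDl subrr.
move=> t /andP[t1 t2] rt; exists t => //.
by rewrite ler_norml; apply/andP; split; lra.
Qed.

(** * First-order expansion near the Hermite roots *)

Lemma norm2_ge0 (R : realType) (n : nat) (u : 'rV[R]_n) : 0 <= norm2 u.
Proof. exact: sqrtr_ge0. Qed.

Lemma norm2_sqr (R : realType) (n : nat) (u : 'rV[R]_n) :
  norm2 u ^+ 2 = \sum_i u 0 i ^+ 2.
Proof. by rewrite sqr_sqrtr // sumr_ge0 // => i _; rewrite sqr_ge0. Qed.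

Lemma norm2_entry (R : realType) (n : nat) (u : 'rV[R]_n) (i : 'I_n) :
  `|u 0 i| <= norm2 u.
Proof.
rewrite -[leLHS]sqrtr_sqr ?normr_id ler_wsqrtr //.
by rewrite (bigD1 i) //= lerDl sumr_ge0 // => j _; rewrite sqr_ge0.
Qed.

(** * Orders of smallness in the displacement of the roots *)

Section BigO.
Variables (R : realType) (n : nat).
Implicit Types f g : 'rV[R]_n -> R.

(** Stated on the whole unit ball and not as a germ at 0, so that constants combine directly and a
    higher order implies a lower one. *)
Definition bigO (k : nat) f : Prop :=
  exists2 K, 0 <= K & forall u, norm2 u <= 1 -> `|f u| <= K * norm2 u ^+ k.

Lemma bigO_ext k f g : f =1 g -> bigO k f -> bigO k g.
Proof. by move=> fg [K K0 Kf]; exists K => // u u1; rewrite -fg Kf. Qed.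

Lemma bigOD k f g : bigO k f -> bigO k g -> bigO k (fun u => f u + g u).
Proof.
move=> [K K0 Kf] [L L0 Lg]; exists (K + L); first exact: addr_ge0.
move=> u u1; rewrite mulrDl (le_trans (ler_normD _ _)) // lerD ?Kf ?Lg //.
Qed.

Lemma bigOM k l f g : bigO k f -> bigO l g -> bigO (k + l) (fun u => f u * g u).
Proof.
move=> [K K0 Kf] [L L0 Lg]; exists (K * L); first exact: mulr_ge0.
by move=> u u1; rewrite normrM exprD mulrACA ler_pM ?Kf ?Lg.
Qed.

Lemma bigO_cst (c : R) : bigO 0 (fun=> c).
Proof. by exists `|c| => // u _; rewrite expr0 mulr1. Qed.

Lemma bigOZ k (c : R) f : bigO k f -> bigO k (fun u => c * f u).
Proof. exact: (bigOM (bigO_cst c)). Qed.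

Lemma bigON k f : bigO k f -> bigO k (fun u => - f u).
Proof. by move=> /(bigOZ (-1)); apply: bigO_ext => u; rewrite mulN1r. Qed.

Lemma bigO_weaken k l f : (l <= k)%N -> bigO k f -> bigO l f.
Proof.
move=> lk [K K0 Kf]; exists K => // u u1; rewrite (le_trans (Kf _ u1)) //.
by rewrite ler_wpM2l // -(subnKC lk) exprD ler_piMr ?exprn_ge0 ?norm2_ge0 // exprn_ile1 ?norm2_ge0.
Qed.

Lemma bigO0 k : bigO k (fun=> 0).
Proof. by exists 0 => // u _; rewrite mul0r normr0. Qed.

Lemma bigO_sum k (I : Type) (r : seq I) (P : pred I) (f : I -> 'rV[R]_n -> R) :
  (forall i, P i -> bigO k (f i)) -> bigO k (fun u => \sum_(i <- r | P i) f i u).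
Proof.
move=> H; elim: r => [|i r IH].
  by apply: bigO_ext (bigO0 k) => u; rewrite big_nil.
have [Pi|Pi] := boolP (P i).
  by apply: bigO_ext (bigOD (H i Pi) IH) => u; rewrite big_cons Pi.
by apply: bigO_ext IH => u; rewrite big_cons (negbTE Pi).
Qed.

Lemma bigO_entry (i : 'I_n) : bigO 1 (fun u => u 0 i).
Proof. by exists 1 => // u _; rewrite mul1r expr1 norm2_entry. Qed.

Lemma bigO_prod1 (I : Type) (r : seq I) (P : pred I) (f : I -> 'rV[R]_n -> R) :
  (forall i, P i -> bigO 1 (fun u => f i u - 1)) ->
  bigO 1 (fun u => \prod_(i <- r | P i) f i u - 1).
Proof.
move=> H; elim: r => [|i r IH].
  by apply: bigO_ext (bigO0 1) => u; rewrite big_nil subrr.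
have [Pi|Pi] := boolP (P i); last first.
  by apply: bigO_ext IH => u; rewrite big_cons (negbTE Pi).
(* Uses ab - 1 = (a-1)(b-1) + (a-1) + (b-1). *)
have A := bigO_weaken (isT : (1 <= 1 + 1)%N) (bigOM (H i Pi) IH).
apply: bigO_ext (bigOD (bigOD A (H i Pi)) IH) => u.
by rewrite big_cons Pi; ring.
Qed.

Lemma bigO_unif k (I : finType) (f : I -> 'rV[R]_n -> R) : (forall i, bigO k (f i)) ->
  exists2 K, 0 <= K & forall i u, norm2 u <= 1 -> `|f i u| <= K * norm2 u ^+ k.
Proof.
move=> H.
have [K K0 KH] : bigO k (fun u => \sum_i `|f i u|).
  apply: bigO_sum => i _; have [K K0 Kf] := H i.
  by exists K => // u u1; rewrite normr_id Kf.
exists K => // i u u1; apply: le_trans (KH u u1).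
rewrite (ger0_norm (sumr_ge0 _ _)); last by move=> *; exact: normr_ge0.
by rewrite (bigD1 i) //= lerDl sumr_ge0.
Qed.

End BigO.

(** * Linearization of the symbols and of the recentred polynomials *)

Section Estimates.
Variables (R : realType) (n : nat) (h : 'rV[R]_n).
Hypotheses (inc_h : increasing h) (hE : polyr h = hermite R n).
Variable (c : R).

Let orth_coord := orth_coord h.

(* The operator F with [polyr (h + u) = F(D) He_n]; see [polyr_op_ser]. *)
Definition op_ser (u : 'rV[R]_n) : {poly R} := \poly_(k < n.+1)
  (if k is k'.+1 then orth_coord k' (fun j => (polyr (h + u)).[h 0 j] / hermite_slope h j) else 1).

Lemma polyr_op_ser (u : 'rV[R]_n) : polyr (h + u) = hermite_op n (op_ser u).
Proof. by apply: monic_hermite_op => //; rewrite ?monic_polyr ?size_polyr. Qed.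

Lemma op_ser0 (u : 'rV[R]_n) : (op_ser u)`_0 = 1. Proof. by rewrite coef_poly. Qed.

(* The operator of the next iterate, [F(ct)^2]. *)
Definition next_ser (u : 'rV[R]_n) : {poly R} := (op_ser u * op_ser u) \Po (c *: 'X).

Lemma next_ser_0 (u : 'rV[R]_n) : (next_ser u)`_0 = 1.
Proof. by rewrite coef_comp_scaleX expr0 mul1r coefM big_ord1 !op_ser0 mulr1. Qed.

(** The quotient equals -u_j times the product over i != j of 1 - u_i/(h_j - h_i), and this product
    is 1 up to first order. *)
Lemma bigO_newton (j : 'I_n) :
  bigO 2 (fun u => (polyr (h + u)).[h 0 j] / hermite_slope h j + u 0 j).
Proof.
have H : bigO 1 (fun u => \prod_(i < n | i != j) (1 - (h 0 j - h 0 i)^-1 * u 0 i) - 1).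
  apply: bigO_prod1 => i ij.
  apply: bigO_ext (bigON (bigOZ (h 0 j - h 0 i)^-1 (bigO_entry R i))) => u.
  by rewrite [RHS]addrC addKr.
apply: bigO_ext (bigON (bigOM (bigO_entry R j) H)) => u.
rewrite /hermite_slope -hE deriv_polyr horner_polyr [X in X / _](bigD1 j) //= mxE opprD addrA subrr sub0r.
rewrite -[_ * _ / _]mulrA -prodf_div mulrBr mulr1 opprB [RHS]addrC mulNr; congr (_ - _ * _).
apply: eq_bigr => i ij; rewrite mxE.
have : h 0 j - h 0 i != 0.
  by rewrite subr_eq0; apply: contra ij => /eqP/(increasing_inj inc_h)->.
by move: (h 0 j) (h 0 i) => a b ab; field.
Qed.

Definition root_coord (k : nat) (u : 'rV[R]_n) : R := orth_coord k (u 0).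

Lemma bigO_root_coord (k : nat) : bigO 1 (root_coord k).
Proof. by apply: bigO_sum => i _; apply: bigOZ; apply: bigO_entry. Qed.

(** To first order the symbol coefficients are minus the coordinates of the root displacement. *)
Lemma bigO_op_ser_root_coord (k : nat) : (k < n)%N ->
  bigO 2 (fun u => (op_ser u)`_k.+1 + root_coord k u).
Proof.
move=> kn; have H : bigO 2 (fun u => \sum_(j < n)
    orth_vec h k j * ((polyr (h + u)).[h 0 j] / hermite_slope h j + u 0 j)).
  by apply: bigO_sum => j _; apply: bigOZ; apply: bigO_newton.
apply: bigO_ext H => u; rewrite coef_poly ltnS kn -big_split /=.
by apply: eq_bigr => j _; rewrite mulrDr.
Qed.

Lemma bigO_op_ser (k : nat) : (k < n)%N -> bigO 1 (fun u => (op_ser u)`_k.+1).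
Proof.
move=> kn; have H := bigO_weaken (isT : (1 <= 2)%N) (bigO_op_ser_root_coord kn).
apply: bigO_ext (bigOD H (bigON (bigO_root_coord k))) => u; exact: addrK.
Qed.

(** In the Cauchy square of F, whose constant term is 1, the two end terms give 2 c^(k+1) F_(k+1);
    every other term is a product of two small coefficients. *)
Lemma bigO_next_ser_root_coord (k : nat) : (k < n)%N ->
  bigO 2 (fun u => (next_ser u)`_k.+1 + 2 * c ^+ k.+1 * root_coord k u).
Proof.
move=> kn; have H : bigO 2 (fun u => \sum_(j < k) (op_ser u)`_j.+1 * (op_ser u)`_(k - j)).
  apply: bigO_sum => j _.
  have [m km] : exists m, (k - j = m.+1)%N.
    by exists (k - j).-1; rewrite prednK // subn_gt0.
  rewrite km; apply: (@bigOM _ _ 1 1); apply: bigO_op_ser; have := ltn_ord j; lia.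
have H2 := bigOZ (2 * c ^+ k.+1) (bigO_op_ser_root_coord kn).
apply: bigO_ext (bigOD H2 (bigOZ (c ^+ k.+1) H)) => u.
rewrite coef_comp_scaleX coefM big_ord_recl big_ord_recr /= op_ser0 subn0 subnn op_ser0.
rewrite /bump /= add1n mul1r mulr1.
set S := \sum_(i < k) _.
ring.
Qed.

Lemma bigO_next_ser (k : nat) : (k < n)%N -> bigO 1 (fun u => (next_ser u)`_k.+1).
Proof.
move=> kn; have H := bigO_weaken (isT : (1 <= 2)%N) (bigO_next_ser_root_coord kn).
apply: bigO_ext (bigOD H (bigON (bigOZ (2 * c ^+ k.+1) (bigO_root_coord k)))) => u.
exact: addrK.
Qed.

(** The linearization at h of the map on roots: coordinate k is multiplied by 2 c^(k+1). *)
Definition linear_shift (u : 'rV[R]_n) (i : 'I_n) : R :=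
  \sum_(k < n) orth_weight R n k * orth_vec h k i * (2 * c ^+ k.+1 * root_coord k u).

Lemma bigO_linear_shift (i : 'I_n) : bigO 1 (fun u => linear_shift u i).
Proof. by apply: bigO_sum => k _; do 2!apply: bigOZ; apply: bigO_root_coord. Qed.

(* The polynomial of the next iterate, recentred at [h_i] and normalized to have
   slope close to 1, the form used by [quadratic_root_approx]. *)
Definition shifted (u : 'rV[R]_n) (i : 'I_n) : {poly R} :=
  (hermite_slope h i)^-1 *: (hermite_op n (next_ser u) \Po ('X + (h 0 i)%:P)).

Lemma shiftedE (u : 'rV[R]_n) (i : 'I_n) (k : nat) : (shifted u i)`_k =
  (hermite_slope h i)^-1 * (hermite R n \Po ('X + (h 0 i)%:P))`_k +
  \sum_(l < n) (hermite_slope h i)^-1 * orth_weight R n l * (hermite R (n - l.+1) \Po ('X + (h 0 i)%:P))`_k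
     * (next_ser u)`_l.+1.
Proof.
rewrite coefZ hermite_op_recl ?next_ser_0 // comp_polyD coefD mulrDr; congr (_ + _).
rewrite raddf_sum coef_sum mulr_sumr; apply: eq_bigr => l _.
rewrite /= comp_polyZ coefZ; ring.
Qed.

Lemma comp_shift0 (p : {poly R}) (a : R) : (p \Po ('X + a%:P))`_0 = p.[a].
Proof. by rewrite -horner_coef0 horner_comp hornerD hornerX hornerC add0r. Qed.

Lemma comp_shift1 (p : {poly R}) (a : R) : (p \Po ('X + a%:P))`_1 = p^`().[a].
Proof.
have := coef_deriv (p \Po ('X + a%:P)) 0; rewrite mulr1n => <-.
by rewrite deriv_comp derivD derivX derivC addr0 mulr1 comp_shift0.
Qed.

Lemma shifted0 (u : 'rV[R]_n) (i : 'I_n) :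
  (shifted u i)`_0 = \sum_(k < n) orth_weight R n k * orth_vec h k i * (next_ser u)`_k.+1.
Proof.
rewrite shiftedE comp_shift0 root_hermite // mulr0 add0r; apply: eq_bigr => k _.
by rewrite comp_shift0 /orth_vec; ring.
Qed.

(** The Newton approximation to the displacement of the i-th root is minus this constant
    coefficient, so it agrees with the linearization up to second order. *)
Lemma bigO_shifted0 (i : 'I_n) : bigO 2 (fun u => (shifted u i)`_0 + linear_shift u i).
Proof.
have H : bigO 2 (fun u => \sum_(k < n) orth_weight R n k * orth_vec h k i *
    ((next_ser u)`_k.+1 + 2 * c ^+ k.+1 * root_coord k u)).
  by apply: bigO_sum => k _; apply: bigOZ; apply: bigO_next_ser_root_coord.
apply: bigO_ext H => u; rewrite shifted0 -big_split /=.
by apply: eq_bigr => k _; rewrite mulrDr.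
Qed.

Lemma bigO_shifted (i : 'I_n) (k : nat) :
  bigO 1 (fun u => (shifted u i)`_k - (hermite_slope h i)^-1 * (hermite R n \Po ('X + (h 0 i)%:P))`_k).
Proof.
have H : bigO 1 (fun u => \sum_(l < n) (hermite_slope h i)^-1 * orth_weight R n l *
    (hermite R (n - l.+1) \Po ('X + (h 0 i)%:P))`_k * (next_ser u)`_l.+1).
  by apply: bigO_sum => l _; apply: bigOZ; apply: bigO_next_ser.
by apply: bigO_ext H => u; rewrite shiftedE [RHS]addrC addKr.
Qed.

Lemma size_shifted (u : 'rV[R]_n) (i : 'I_n) : (size (shifted u i) <= n.+1)%N.
Proof.
rewrite (leq_trans (size_scale_leq _ _)) // size_comp_poly2 ?size_hermite_op //.
exact: size_XaddC.
Qed.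

End Estimates.

(** * Contraction in one step *)

Definition same_top (R : realType) (n : nat) (p : {poly R}) : Prop :=
  forall k, (k <= 2)%N -> p`_(n - k) = (hermite R n)`_(n - k).

Lemma finite_pos_lower_bound (R : realType) (I : finType) (P : pred I) (f : I -> R) :
  (forall i, P i -> 0 < f i) -> exists2 g, 0 < g & forall i, P i -> g <= f i.
Proof.
(* The summand 1 keeps the witness positive for an empty family. *)
move=> f0; exists (1 + \sum_(i | P i) (f i)^-1)^-1.
  by rewrite invr_gt0 ltr_wpDr // sumr_ge0 // => i /f0/ltW; rewrite invr_ge0.
move=> i Pi; rewrite -[leRHS]invrK lef_pV2 ?posrE ?invr_gt0 ?f0 //.
  rewrite (bigD1 i) //= addrCA lerDl addr_ge0 // sumr_ge0 // => j /andP[/f0/ltW].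
  by rewrite invr_ge0.
by rewrite ltr_wpDr // sumr_ge0 // => j /f0/ltW; rewrite invr_ge0.
Qed.

Section OneStep.
Variables (R : realType) (n : nat) (h : 'rV[R]_n).
Hypotheses (n3 : (3 <= n)%N) (inc_h : increasing h) (hE : polyr h = hermite R n).
Variable (c : R).
Hypotheses (c_gt0 : 0 < c) (c2 : c ^+ 2 = 2^-1).

Lemma op_ser_top (u : 'rV[R]_n) : same_top n (polyr (h + u)) ->
  (op_ser h u)`_1 = 0 /\ (op_ser h u)`_2 = 0.
Proof.
rewrite (polyr_op_ser inc_h hE) => H; exact: hermite_op_coef12 (ltnW n3) (op_ser0 h u) H.
Qed.

(** If F = 1 + O(t^3), so is F(ct)^2, and the terms from t^3 on involve only Hermite polynomials of
    degree at most n-3. *)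
Lemma next_ser_top (u : 'rV[R]_n) : same_top n (polyr (h + u)) ->
  same_top n (hermite_op n (next_ser h c u)).
Proof.
move=> /op_ser_top[F1 F2].
have G1 : (next_ser h c u)`_1 = 0.
  rewrite coef_comp_scaleX coefM !big_ord_recl big_ord0 /= /bump /=.
  by rewrite subn0 addn0 F1 mulr0 mul0r !addr0 mulr0.
have G2 : (next_ser h c u)`_2 = 0.
  rewrite coef_comp_scaleX coefM !big_ord_recl big_ord0 /= /bump /=.
  by rewrite subn0 !addn0 addn1 F1 F2 !(mulr0, mul0r) !addr0 mulr0.
move=> k k2; rewrite hermite_op_recl ?next_ser_0 // coefD coef_sum big1 ?addr0 // => -[j jn] _ /=.
rewrite coefZ; case: j jn => [|[|j]] jn; rewrite ?G1 ?G2 ?mulr0 ?mul0r //.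
rewrite (_ : (hermite _ _)`_ _ = 0) ?mulr0 // nth_default // size_hermite; lia.
Qed.

Lemma sum_sqr_linear_shift (u : 'rV[R]_n) : \sum_i linear_shift h c u i ^+ 2 =
  \sum_(k < n) orth_weight R n k * (2 * c ^+ k.+1 * root_coord h k u) ^+ 2.
Proof.
rewrite (orth_coord_parseval inc_h hE); apply: eq_bigr => k _; congr (_ * _ ^+ 2).
exact: (orth_coord_synth inc_h hE (fun k => 2 * c ^+ k.+1 * root_coord h k u)).
Qed.

(** The squared factor of coordinate k is 2 * 2^(-k), at most 1/2 for k >= 2. Coordinates 0 and 1,
    which belong to t and t^2, are not contracted enough and are charged to d. *)
Lemma linear_shift_contract (u : 'rV[R]_n) (d : R) :
  `|root_coord h 0 u| <= d -> `|root_coord h 1 u| <= d ->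
  \sum_i linear_shift h c u i ^+ 2 <= 2^-1 * norm2 u ^+ 2 + (\sum_(k < n) 2 * orth_weight R n k) * d ^+ 2.
Proof.
move=> y0 y1; have d0 : 0 <= d := le_trans (normr_ge0 _) y0.
rewrite sum_sqr_linear_shift norm2_sqr (orth_coord_parseval inc_h hE) mulr_sumr mulr_suml -big_split /=.
apply: ler_sum => k _; rewrite -/(root_coord h k u).
have sq (y : R) : `|y| <= d -> y ^+ 2 <= d ^+ 2.
  by move=> yd; rewrite -[y ^+ 2]ger0_norm ?sqr_ge0 // normrX lerXn2r ?nnegrE.
have w0 := orth_weight_ge0 R n k; set w := orth_weight R n k in w0 *; set y := root_coord h k u.
have -> : (2 * c ^+ k.+1 * y) ^+ 2 = 2 * 2^-1 ^+ k * y ^+ 2.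
  rewrite !exprMn -exprM mulnC exprM c2 (exprSr _ k).
  move: (2^-1 ^+ k : R) => z; by field.
have [k2|k2] := ltnP k 2; last first.
  apply: (@le_trans _ _ (2^-1 * (w * y ^+ 2))); last first.
    by rewrite lerDl !mulr_ge0 ?sqr_ge0.
  rewrite mulrCA ler_wpM2r //; first by rewrite (mulr_ge0 w0 (sqr_ge0 _)).
  have e2 : 2 * 2^-1 ^+ 2 = 2^-1 :> R by field.
  by rewrite -(subnKC k2) exprD mulrA e2 ler_piMr ?exprn_ile1 ?invr_ge0 ?invf_le1 ?ler1n.
have yd : y ^+ 2 <= d ^+ 2.
  by apply: sq; rewrite /y; case: (k : nat) k2 => [|[|]].
apply: (@le_trans _ _ (2 * w * d ^+ 2)); last first.
  by rewrite lerDr (mulr_ge0 _ (mulr_ge0 w0 (sqr_ge0 _))) ?invr_ge0.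
rewrite (_ : 2 * w * _ = w * (2 * d ^+ 2)); last by ring.
rewrite ler_wpM2l // ler_pM ?sqr_ge0 ?mulr_ge0 ?exprn_ge0 ?invr_ge0 //.
by rewrite ler_piMr // exprn_ile1 ?invr_ge0 ?invf_le1 ?ler1n.
Qed.

Lemma hermite_op_roots (F : {poly R}) (s : 'rV[R]_n) : F`_0 = 1 -> increasing s ->
  (forall i, root (hermite_op n F) (s 0 i)) -> polyr s = hermite_op n F.
Proof.
move=> F0 inc_s rs.
have Hn : (hermite_op n F)`_n = 1.
  rewrite hermite_op_recl // coefD coef_sum big1 ?addr0 => [|k _].
    by have := monicP (hermite_monic R n); rewrite /lead_coef size_hermite.
  by rewrite coefZ [(hermite _ _)`_ _]nth_default ?mulr0 // size_hermite; have := ltn_ord k; lia.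
have sH : size (hermite_op n F) = n.+1.
  apply/eqP; rewrite eqn_leq size_hermite_op ltnNge; apply/negP => /leq_sizeP/(_ n (leqnn n)).
  by rewrite Hn => /eqP; rewrite oner_eq0.
have := @all_roots_prod_XsubC R (hermite_op n F) [seq s 0 i | i <- enum 'I_n].
rewrite size_map size_enum_ord sH -polyr_seq lead_coefE sH Hn scale1r => -> //.
  by apply/allP => x /mapP[i _ ->].
by rewrite uniq_rootsE map_inj_uniq ?enum_uniq //; apply: increasing_inj.
Qed.

(** Near each h_i the next polynomial has a root, displaced by [linear_shift] up to second order.
    These n roots are distinct and exhaust the degree, and the linear part contracts by c up to
    higher order. *)
Lemma one_step : exists delta C : R, [/\ 0 < delta, 0 <= C &
  forall r : 'rV[R]_n, same_top n (polyr r) -> norm2 (r - h) < delta ->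
    exists s, [/\ increasing_root_vector (dilation n c (boxplus n (polyr r) (polyr r))) s,
      same_top n (polyr s) &
      norm2 (s - h) <= c * norm2 (r - h) * (1 + C * norm2 (r - h))]].
Proof.
have [K1 K10 H1] := bigO_unif (bigO_shifted0 inc_h hE c).
have [K2 K20 H2] := bigO_unif (fun i => bigO_shifted inc_h hE c i 1).
have H3' (p : 'I_n * 'I_n.+1) : bigO 0 (fun u => (shifted h c u p.1)`_p.2).
  have A := bigO_weaken (isT : (0 <= 1)%N) (bigO_shifted inc_h hE c p.1 p.2).
  apply: bigO_ext (bigOD A (bigO_cst _ _)) => u; exact: subrK.
have [K3 K30 H3] := bigO_unif H3'.
have [K4 K40 H4] := bigO_unif (bigO_linear_shift h c).
have [K5 K50 H5] := bigO_unif (fun k : 'I_n => bigO_op_ser_root_coord inc_h hE (ltn_ord k)).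
(* A lower bound for the gaps of h, which keeps the displaced roots in order. *)
have [g g0 Hg] : exists2 g, 0 < g & forall p : 'I_n * 'I_n, (p.1 < p.2)%N -> g <= h 0 p.2 - h 0 p.1.
  by apply: finite_pos_lower_bound => p /inc_h; rewrite subr_gt0.
pose K := K1 + K2 + K3 + K4.
have K0 : 0 <= K by rewrite !addr_ge0.
pose C0 := K * (K + 1) + (K + 1) ^+ 2 * (n.-1%:R * K).
have C00 : 0 <= C0 by rewrite addr_ge0 ?mulr_ge0 ?sqr_ge0 ?addr_ge0.
(* Each summand provides one smallness condition once e N < 1. *)
pose N := 1 + C0 + (K + 1) + 2 * (K + 1) / g.
have gK : 0 <= 2 * (K + 1) / g by rewrite !mulr_ge0 ?addr_ge0 ?invr_ge0 // ltW.
have N0 : 0 < N by rewrite /N; lra.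
pose C1 := C0 + K1.
have C10 : 0 <= C1 by rewrite addr_ge0.
pose S := \sum_(k < n) 2 * orth_weight R n k.
have S0 : 0 <= S by rewrite sumr_ge0 // => k _; rewrite mulr_ge0 ?orth_weight_ge0.
(* The first term collects the error of the squared displacement over the n roots, the second the
   two uncontracted coordinates. *)
pose E := n%:R * (2 * K4 * C1 + C1 ^+ 2) + S * K5 ^+ 2.
have E0 : 0 <= E by rewrite !(addr_ge0, mulr_ge0, sqr_ge0).
exists N^-1, E; split=> //; first by rewrite invr_gt0.
move=> r top; set u := r - h; have rE : r = h + u by rewrite addrC subrK.
rewrite {}rE in top *; have e0 := norm2_ge0 u; set e := norm2 u in e0 * => eN.
have {}eN : e * N < 1 by rewrite -ltr_pdivlMr // mul1r.
have [e1 [Ce [Ke ge]]] : e <= 1 /\ C0 * e <= 1 /\ (K + 1) * e <= 1 /\ 2 * (K + 1) * e < g.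
  have eC : 0 <= e * C0 by rewrite mulr_ge0.
  have eK : 0 <= e * K by rewrite mulr_ge0.
  have eg : 0 <= e * (2 * (K + 1) / g) by exact: mulr_ge0.
  have {}eN : e + e * C0 + (e * K + e) + e * (2 * (K + 1) / g) < 1.
    by rewrite [ltLHS](_ : _ = e * N) // /N; ring.
  have e2 : e * (2 * (K + 1) / g) < 1.
    by move: eN eg; move: (e * (2 * (K + 1) / g)) => z; lra.
  have e3 : e + e * C0 + (e * K + e) <= 1.
    by move: eN eg; move: (e * (2 * (K + 1) / g)) => z; lra.
  do 3![split; first by move: e3; clear e2 eN eg; lra].
  by move: e2; rewrite mulrA ltr_pdivrMr // mul1r; clear eN eg; lra.
have Q0K i : `|(shifted h c u i)`_0| <= K * e.
  have -> : (shifted h c u i)`_0 = ((shifted h c u i)`_0 + linear_shift h c u i) - linear_shift h c u i.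
    by rewrite addrK.
  rewrite (le_trans (ler_normB _ _)) // (le_trans (lerD (H1 i u e1) (H4 i u e1))) //.
  rewrite expr1 -/e; apply: (@le_trans _ _ ((K1 + K4) * e)).
    by rewrite mulrDl lerD2r ler_wpM2l // expr2 ler_piMr.
  by rewrite ler_wpM2r // /K; lra.
have R_ i : exists2 t, root (shifted h c u i) t & `|t + (shifted h c u i)`_0| <= C0 * e ^+ 2.
  (* There are n-1 coefficients in degrees 2 to n. *)
  apply: (@quadratic_root_approx R n.-1 _ K e C0) => //.
  - by rewrite (leq_trans (size_shifted _ _ _ _)) // prednK // (leq_trans _ n3).
  - have := H2 i u e1; rewrite comp_shift1 -/(hermite_slope h i) mulVf ?hermite_slope_neq0 // expr1 -/e.
    by move/le_trans; apply; rewrite ler_wpM2r // /K; lra.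
  move=> k; have [kn|kn] := ltnP k n.+1; last first.
    by rewrite nth_default ?normr0 // (leq_trans (size_shifted _ _ _ _)).
  have := H3 (i, Ordinal kn) u e1; rewrite expr0 mulr1 /=.
  by move/le_trans; apply; rewrite /K; lra.
pose t i := sval (cid2 (R_ i)).
have rt i : root (shifted h c u i) (t i) by rewrite /t; case: cid2.
have tC i : `|t i + (shifted h c u i)`_0| <= C0 * e ^+ 2 by rewrite /t; case: cid2.
have tC1 i : `|t i - linear_shift h c u i| <= C1 * e ^+ 2.
  rewrite (_ : _ - _ = (t i + (shifted h c u i)`_0) - ((shifted h c u i)`_0 + linear_shift h c u i));
    last by ring.
  by rewrite (le_trans (ler_normB _ _)) // mulrDl lerD // H1.
have tK i : `|t i| <= (K + 1) * e.
  rewrite -[t i](addrK (shifted h c u i)`_0) (le_trans (ler_normB _ _)) //.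
  rewrite mulrDl mul1r addrC lerD // (le_trans (tC i)) //.
  by rewrite expr2 mulrA ler_piMl.
pose s : 'rV[R]_n := \row_i (h 0 i + t i).
have inc_s : increasing s.
  move=> i j ij; rewrite !mxE -subr_gt0.
  have := Hg (i, j) ij; have := tK i; have := tK j; rewrite /= !ler_norml => /andP[a _] /andP[_ b] d.
  lra.
have dE : dilation n c (boxplus n (polyr (h + u)) (polyr (h + u))) = hermite_op n (next_ser h c u).
  by rewrite (polyr_op_ser inc_h hE) hermite_op_dilation_boxplus.
have sE : polyr s = hermite_op n (next_ser h c u).
  apply: hermite_op_roots => //; first exact: next_ser_0.
  move=> i; have := rt i; rewrite /shifted rootZ ?invr_eq0 ?hermite_slope_neq0 //.
  by rewrite /root horner_comp hornerD hornerX hornerC mxE addrC.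
exists s; split; first by split; rewrite // dE.
  by rewrite sE; apply: next_ser_top.
(* With F_1 = F_2 = 0, the two uncontracted coordinates are themselves of order e^2. *)
have [F1 F2] := op_ser_top top.
have T0 : `|root_coord h 0 u| <= K5 * e ^+ 2.
  by have := H5 (Ordinal (ltn_trans (isT : 0 < 2)%N n3)) u e1; rewrite /= F1 add0r.
have T1 : `|root_coord h 1 u| <= K5 * e ^+ 2.
  by have := H5 (Ordinal (ltn_trans (isT : 1 < 2)%N n3)) u e1; rewrite /= F2 add0r.
have := linear_shift_contract T0 T1; rewrite -/e -/S => LD.
have tsq i : t i ^+ 2 <= linear_shift h c u i ^+ 2 + (2 * K4 * C1 + C1 ^+ 2) * e ^+ 3.
  have A := H4 i u e1; have B := tC1 i; rewrite expr1 -/e in A.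
  have AB : `|linear_shift h c u i * (t i - linear_shift h c u i)| <= K4 * e * (C1 * e ^+ 2).
    by rewrite normrM ler_pM.
  have {}AB := le_trans (ler_norm _) AB.
  have BB : (t i - linear_shift h c u i) ^+ 2 <= C1 ^+ 2 * e ^+ 3.
    rewrite -[leLHS]ger0_norm ?sqr_ge0 // normrX; apply: (@le_trans _ _ ((C1 * e ^+ 2) ^+ 2)).
      by rewrite lerXn2r ?nnegrE // mulr_ge0 ?sqr_ge0.
    rewrite exprMn ler_wpM2l ?sqr_ge0 // -exprM (_ : 2 * 2 = 3.+1)%N // exprSr.
    by rewrite ler_piMr ?exprn_ge0.
  have -> : t i ^+ 2 = linear_shift h c u i ^+ 2 +
      2 * (linear_shift h c u i * (t i - linear_shift h c u i)) + (t i - linear_shift h c u i) ^+ 2 by ring.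
  have -> : (2 * K4 * C1 + C1 ^+ 2) * e ^+ 3 = 2 * (K4 * e * (C1 * e ^+ 2)) + C1 ^+ 2 * e ^+ 3 by ring.
  rewrite addrA lerD // lerD2l; lra.
have sh : norm2 (s - h) ^+ 2 = \sum_i t i ^+ 2.
  by rewrite norm2_sqr; apply: eq_bigr => i _; rewrite !mxE addrC addKr.
have e3 : 0 <= e ^+ 3 by rewrite exprn_ge0.
have total : norm2 (s - h) ^+ 2 <= 2^-1 * e ^+ 2 + E * e ^+ 3.
  rewrite sh (le_trans (ler_sum _ (fun i _ => tsq i))) //.
  rewrite big_split /= sumr_const card_ord -[_ *+ n]mulr_natl.
  rewrite (le_trans (lerD LD (lexx _))) // -addrA lerD2l /E [leRHS]mulrDl addrC mulrA lerD2l.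
  rewrite exprMn mulrA ler_wpM2l ?mulr_ge0 ?sqr_ge0 //.
  by rewrite -exprM (_ : 2 * 2 = 3.+1)%N // exprSr ler_piMr.
(* Squared, the claimed bound is e^2/2 + E e^3 + E^2 e^4/2, which dominates [total]. *)
rewrite -(@ler_pXn2r _ 2) ?nnegrE ?norm2_ge0 //; last first.
  by rewrite !mulr_ge0 ?addr_ge0 ?mulr_ge0 // ltW.
apply: le_trans total _; rewrite !exprMn c2.
have E2 : 0 <= E ^+ 2 * e ^+ 4 by rewrite mulr_ge0 ?exprn_ge0.
have -> : 2^-1 * e ^+ 2 * (1 + E * e) ^+ 2 =
  2^-1 * e ^+ 2 + E * e ^+ 3 + 2^-1 * (E ^+ 2 * e ^+ 4) by field.
by rewrite lerDl mulr_ge0.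
Qed.
End OneStep.

(** * Iteration *)

Lemma increasing_sorted (R : realType) (n : nat) (r : 'rV[R]_n) : increasing r ->
  sorted <%R [seq r 0 i | i <- enum 'I_n].
Proof.
move=> ir; apply: (homo_sorted (e := relpre val ltn)) => [i j /ir //|].
by rewrite -sorted_map val_enum_ord iota_ltn_sorted.
Qed.

Lemma increasing_root_vector_uniq (R : realType) (n : nat) (p : {poly R}) (r s : 'rV[R]_n) :
  increasing_root_vector p r -> increasing_root_vector p s -> r = s.
Proof.
move=> [ir rp] [is_ sp].
have : [seq r 0 i | i <- enum 'I_n] = [seq s 0 i | i <- enum 'I_n].
  apply: (irr_sorted_eq lt_trans ltxx); rewrite ?increasing_sorted // => x.
  by rewrite -!root_prod_XsubC -!polyr_seq rp sp.
move/eq_in_map => E; apply/rowP => i; apply: E; exact: mem_enum.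
Qed.

(** Exhibiting one root vector excludes the default value of [xget], and uniqueness identifies the
    chosen one. *)
Lemma Tn_eq (R : realType) (n : nat) (r s : 'rV[R]_n) :
  increasing_root_vector (dilation n (2 `^ (- 2^-1)) (boxplus n (polyr r) (polyr r))) s ->
  Tn r = s.
Proof.
move=> Hs; apply: (increasing_root_vector_uniq _ Hs).
exact: (xgetPex 0 (ex_intro _ s Hs)).
Qed.

Lemma Mn_same_top (R : realType) (n : nat) (h r : 'rV[R]_n) : (2 <= n)%N ->
  polyr h = hermite R n -> Mn R n h -> Mn R n r -> same_top n (polyr r).
Proof.
move=> n2 hE [_ h1 h2] [_ r1 r2] k k2; rewrite -hE; apply: polyr_coef_eq => //.
  by rewrite h1 r1.
by rewrite -!norm2_sqr h2 r2.
Qed.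

Lemma rsqrt2_gt0 (R : realType) : 0 < 2 `^ (- 2^-1) :> R.
Proof. exact: powR_gt0. Qed.

Lemma rsqrt2_sqr (R : realType) : (2 `^ (- 2^-1)) ^+ 2 = 2^-1 :> R.
Proof.
rewrite -powR_mulrn ?powR_ge0 // -powRrM mulNr mulVf ?pnatr_eq0 //.
exact: powR_inv1.
Qed.

Lemma rsqrt2_expn (R : realType) (k : nat) : 2 `^ (- (k%:R / 2)) = (2 `^ (- 2^-1)) ^+ k :> R.
Proof.
by rewrite -powR_mulrn ?powR_ge0 // -powRrM mulNr mulrC.
Qed.

(* The potential [e exp (B e)] absorbs the factors [1 + C e], so that their product
   along the orbit need not be estimated. *)
Lemma potential_step (R : realType) (c C e e' : R) : 0 <= c -> c ^+ 2 = 2^-1 -> 0 <= C ->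
  0 <= e -> C * e <= 15^-1 -> e' <= c * e * (1 + C * e) ->
  e' <= e /\ e' * expR ((5 * C + 1) * e') <= c * (e * expR ((5 * C + 1) * e)).
Proof.
move=> c0 c2 C0 e0 Ce He'.
have c34 : c <= 3 / 4.
  rewrite leNgt; apply/negP => c34; have : c ^+ 2 > (3 / 4) ^+ 2.
    by rewrite ltrXn2r.
  by rewrite c2; lra.
(* The threshold 1/15 is chosen for 3/4 * 16/15 = 4/5. *)
have e45 : e' <= 4 / 5 * e.
  apply: (le_trans He'); rewrite mulrAC ler_wpM2r //.
  apply: (@le_trans _ _ (3 / 4 * (16 / 15))); last by lra.
  by apply: ler_pM => //; [have := mulr_ge0 C0 e0|]; lra.
split; first by lra.
have [e'0|e'0] := leP e' 0.
  apply: (@le_trans _ _ 0).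
    by rewrite mulr_le0_ge0 // expR_ge0.
  by rewrite !mulr_ge0 ?expR_ge0.
apply: (@le_trans _ _ (c * e * (1 + C * e) * expR ((5 * C + 1) * (4 / 5 * e)))).
  apply: ler_pM => //; rewrite ?expR_ge0 ?(ltW e'0) // ler_expR ler_wpM2l //.
  by rewrite addr_ge0 // mulr_ge0.
rewrite mulrA -mulrA ler_wpM2l ?mulr_ge0 //.
(* The exponent drops by a fifth of (5C+1)e, which covers the C e paid for the factor 1 + C e. *)
apply: (@le_trans _ _ (expR (C * e) * expR ((5 * C + 1) * (4 / 5 * e)))).
  by rewrite ler_wpM2r ?expR_ge0 // expR_ge1Dx.
rewrite -expRD ler_expR; have := mulr_ge0 C0 e0; lra.
Qed.

(** Convergence of row vectors gives convergence of the entries, from which the Euclidean norm is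
    assembled. *)
Lemma cvg_norm2_sub (R : realType) (n : nat) (h : 'rV[R]_n) :
  norm2 (r - h) @[r --> h] --> (0 : R).
Proof.
have H i : (r - h) 0 i ^+ 2 @[r --> h] --> (0 : R).
  have E : (fun r : 'rV[R]_n => (r - h) 0 i ^+ 2) =
      (fun r => (r 0 i - h 0 i) * (r 0 i - h 0 i)).
    by apply/funext => r; rewrite !mxE expr2.
  have H : r 0 i - h 0 i @[r --> h] --> h 0 i - h 0 i.
    by apply: cvgB; [exact: coord_continuous | exact: cvg_cst].
  by rewrite E; have := cvgM H H; rewrite subrr mulr0; apply.
have HS : \sum_i (r - h) 0 i ^+ 2 @[r --> h] --> (0 : R).
  have := @cvg_big _ _ +%R 0 xpredT (@add_continuous R) _ _ (index_enum 'I_n) _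
    (fun=> 0) (nbhs_filter h) (fun i _ => H i).
  by rewrite big1_eq; apply.
by have := cvg_comp _ _ HS (@sqrt_continuous R 0); rewrite sqrtr0.
Qed.

Theorem corollaryB3 (R : realType) (n : nat) (hn : (3 <= n)%N)
    (h : 'rV[R]_n) (hM : Mn R n h)
    (hHe : increasing_root_vector (hermite R n) h) :
  exists delta B : R,
    [/\ 0 < delta, 0 < B,
        forall r : 'rV[R]_n, Mn R n r -> norm2 (r - h) < delta ->
          forall k : nat,
            norm2 (iter k (@Tn R n) r - h)
              <= expR (B * norm2 (r - h)) * 2 `^ (- (k%:R / 2))
                 * norm2 (r - h)
      & expR (B * norm2 (r - h)) @[r --> within (Mn R n) (nbhs h)] --> (1 : R)].
Proof.
have [inc_h hE] := hHe; have n2 : (2 <= n)%N := ltnW hn.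
pose c : R := 2 `^ (- 2^-1).
have c0 : 0 < c := rsqrt2_gt0 R; have c2 : c ^+ 2 = 2^-1 := rsqrt2_sqr R.
have [d [C [d0 C0 H]]] := one_step hn inc_h hE c0 c2.
pose B := 5 * C + 1.
have B0 : 0 < B by rewrite /B; lra.
have C15 : 0 < 15 * (C + 1) by lra.
(* The radius d serves [one_step]; the other one gives C e <= 1/15 for [potential_step]. *)
exists (Num.min d (15 * (C + 1))^-1), B; split=> //.
- by rewrite lt_min d0 invr_gt0.
- move=> r Mr; rewrite lt_min => /andP[rd rC] k.
  (* Along the orbit, agreement of the top coefficients replaces membership in [Mn]. The distance
     stays below its initial value, hence within both radii, and the potential decays by c at each
     step. *)
  suff [_ _ ] : [/\ same_top n (polyr (iter k (@Tn R n) r)),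
      norm2 (iter k (@Tn R n) r - h) <= norm2 (r - h) &
      norm2 (iter k (@Tn R n) r - h) * expR (B * norm2 (iter k (@Tn R n) r - h)) <=
        c ^+ k * (norm2 (r - h) * expR (B * norm2 (r - h)))].
    move=> A; rewrite rsqrt2_expn -/c.
    rewrite [leRHS](_ : _ = c ^+ k * (norm2 (r - h) * expR (B * norm2 (r - h)))); last by ring.
    apply: le_trans A; rewrite ler_peMr ?norm2_ge0 //.
    by rewrite (le_trans _ (expR_ge1Dx _)) // lerDl mulr_ge0 ?norm2_ge0 // ltW.
  elim: k => [|k [top le pot]].
    by split; rewrite ?expr0 ?mul1r //=; apply: Mn_same_top hM Mr.
  set rk := iter k _ r in top le pot *.
  have [s [/Tn_eq sE tops es]] := H rk top (le_lt_trans le rd).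
  have Ce : C * norm2 (rk - h) <= 15^-1.
    have := le_lt_trans le rC; rewrite -[X in _ < X]mul1r ltr_pdivlMr // => A.
    have := norm2_ge0 (rk - h); lra.
  have [le' pot'] := potential_step (ltW c0) c2 C0 (norm2_ge0 _) Ce es.
  rewrite iterS -/rk sE; split=> //; first exact: le_trans le' le.
  by apply: (le_trans pot'); rewrite exprS -mulrA ler_wpM2l // ltW.
apply: cvg_trans; first by apply: cvg_app; apply: cvg_within.
have HB : B * norm2 (r - h) @[r --> h] --> B * 0.
  exact: (cvgM (cvg_cst B) (@cvg_norm2_sub R n h)).
by have := cvg_comp _ _ HB (@continuous_expR R (B * 0)); rewrite mulr0 expR0.
Qed.
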